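(* Let $n \in \mathbb{N}$, $W \in \mathbb{R}^{n^2 \times n^2}$ and $c \in \mathbb{R}^{n^2}$, and let $f(x) = x^T W x + c^T x$ for $x \in \mathbb{R}^{n^2}$. Let $X \in \mathbb{P}_n$ be a permutation matrix and $x = \mathrm{vec}(X)$. Then for any $d \in \mathbb{R}^{n^2}$ and any $D_1, D_2 \in \mathbb{R}^{n \times n}$ it holds that $f(x) = \tilde f(x; D_1, D_2, d)$.
   Context: $\mathbb{P}_n = \{X \in \{0,1\}^{n \times n} : X^T X = \mathbf{I}_n\}$ is the set of $n \times n$ permutation matrices. For $X \in \mathbb{R}^{n\times n}$, $\mathrm{vec}(X) \in \mathbb{R}^{n^2}$ is the vector obtained by stacking the columns of $X$. $\mathbf{I}_n$ is the $n \times n$ identity matrix, $\otimes$ is the Kronecker product, $\mathrm{diag}(d)$ is the diagonal matrix with diagonal $d$, and $\langle A, B\rangle = \mathrm{tr}(A^T B)$. For $D_1, D_2 \in \mathbb{R}^{n\times n}$ and $d \in \mathbb{R}^{n^2}$ define $$Z(D_1, D_2, d) := D_1 \otimes \mathbf{I}_n + \mathbf{I}_n \otimes D_2 + \mathrm{diag}(d),$$ $$\tilde f(x; D_1, D_2, d) := x^T (W - Z(D_1, D_2, d)) x + (c + d)^T x + \langle \mathbf{I}_n, D_1 + D_2\rangle .$$ *)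

(* Defs.v *)
From mathcomp Require Import all_boot all_order all_algebra.
From mathcomp Require Import reals.
From mathcomp Require Export mxtens.

Set Implicit Arguments.
Unset Strict Implicit.
Unset Printing Implicit Defensive.

Import GRing.Theory.
Local Open Scope ring_scope.

Section Defs.
Variables (R : realType) (n : nat).

Definition permutation_matrix (X : 'M[R]_n) : Prop :=
  (forall i j, X i j = 0 \/ X i j = 1) /\ X^T *m X = 1%:M.

(* [mxvec] concatenates the rows of a matrix into a row vector, so column
   stacking is [mxvec] of the transpose; see [vecE]. *)
Definition vec (X : 'M[R]_n) : 'cV[R]_(n * n) := (mxvec X^T)^T.

Definition frobenius (A B : 'M[R]_n) : R := \tr (A^T *m B).

Definition fobj (W : 'M[R]_(n * n)) (c x : 'cV[R]_(n * n)) : R :=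
  (x^T *m W *m x) 0 0 + (c^T *m x) 0 0.

(* [A *t B] is the Kronecker product; a pair of row (or column) indices
   [(j, i)] is encoded as [j * n + i], the position of [X i j] in [vec X]. *)
Definition Zmx (D1 D2 : 'M[R]_n) (d : 'cV[R]_(n * n)) : 'M[R]_(n * n) :=
  D1 *t 1%:M + 1%:M *t D2 + diag_mx d^T.

Definition ftilde (W : 'M[R]_(n * n)) (c x : 'cV[R]_(n * n))
    (D1 D2 : 'M[R]_n) (d : 'cV[R]_(n * n)) : R :=
  (x^T *m (W - Zmx D1 D2 d) *m x) 0 0 + ((c + d)^T *m x) 0 0
  + frobenius 1%:M (D1 + D2).

End Defs.

Lemma index_allpairs (T1 T2 : eqType) (s : seq T1) (t : seq T2) x y :
  x \in s -> y \in t ->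
  index (x, y) [seq (a, b) | a <- s, b <- t] =
  (index x s * size t + index y t)%N.
Proof.
move=> + yt; elim: s => // a s IHs; rewrite inE /= index_cat.
have [<- _|ax /= xs] := eqVneq a x.
  have pair_inj : injective (pair a : T2 -> T1 * T2)%type by move=> b c [].
  by rewrite mem_map // yt index_map.
rewrite ifN; last by apply/mapP => -[b _ [xa _]]; rewrite xa eqxx in ax.
by rewrite size_map IHs ?mulSn ?addnA.
Qed.

Lemma mxvec_index_val m n (i : 'I_m) (j : 'I_n) :
  mxvec_index i j = (i * n + j)%N :> nat.
Proof.
rewrite /= /enum_rank [enum_rank_in]unlock insubdK; last first.
  by rewrite -topredE /= cardE index_mem mem_enum.
rewrite enumT unlock /= /prod_enum index_allpairs ?mem_enum //.
by rewrite !index_enum_ord size_enum_ord.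
Qed.

Lemma vecE (R : realType) n (X : 'M[R]_n) (i j : 'I_n) :
  vec X (mxtens_index (j, i)) 0 = X i j.
Proof.
have -> : mxtens_index (j, i) = mxvec_index j i.
  by apply: val_inj; rewrite [RHS]mxvec_index_val.
by rewrite mxE mxvecE mxE.
Qed.

(* Main.v *)
Require Import Defs.
From mathcomp Require Import all_boot all_order all_algebra.
From mathcomp Require Import reals ring.
Local Open Scope ring_scope.
Import GRing.Theory.

(** Since [f - ftilde] is [x^T Z x - d^T x - <I, D1 + D2>], it suffices to
    evaluate the three parts of [Z] at [x = vec X].  The standard identity
    [(A ⊗ B) vec X = vec (B X A^T)] turns the Kronecker parts into traces,
    [x^T (A ⊗ B) x = tr (X^T (B X A^T))], and orthogonality of [X] reduces these
    to [tr D1] and [tr D2].  The diagonal part contributes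
    [\sum_k d_k x_k ^ 2], which is [d^T x] because every entry of [x] is 0
    or 1. *)

Lemma sum_mxtens_index (R : nmodType) m n (F : 'I_(m * n) -> R) :
  \sum_k F k = \sum_(j < m) \sum_(i < n) F (mxtens_index (j, i)).
Proof.
rewrite pair_bigA (reindex (@mxtens_index m n)) /=; first by apply: eq_bigr => -[].
by exists (@mxtens_unindex m n) => k _; rewrite ?mxtens_indexK ?mxtens_unindexK.
Qed.

(** In the pair [(j, i)] that indexes [X i j], the left Kronecker factor acts on
    the column index [j] and the right factor on the row index [i]; hence [A]
    multiplies [X] from the right, transposed, and [B] from the left. *)
Lemma tens_mul_vec (R : realType) n (A B X : 'M[R]_n) :
  (A *t B) *m vec X = vec (B *m X *m A^T).
Proof.
apply/matrixP => k l; rewrite ord1 -[k]mxtens_unindexK.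
case: (mxtens_unindex k) => j i; rewrite vecE !mxE sum_mxtens_index.
apply: eq_bigr => j' _; rewrite !mxE mulr_suml.
by apply: eq_bigr => i' _; rewrite tensmxE vecE -mulrA mulrC.
Qed.

Lemma vec_dot (R : realType) n (X Y : 'M[R]_n) :
  ((vec X)^T *m vec Y) 0 0 = frobenius X Y.
Proof.
rewrite mxE sum_mxtens_index; apply: eq_bigr => j _; rewrite mxE.
by apply: eq_bigr => i _; rewrite [(vec X)^T _ _]mxE [X^T _ _]mxE !vecE.
Qed.

Lemma quad_tens_vec (R : realType) n (A B X : 'M[R]_n) :
  ((vec X)^T *m (A *t B) *m vec X) 0 0 = frobenius X (B *m X *m A^T).
Proof. by rewrite -mulmxA tens_mul_vec vec_dot. Qed.

(** Idempotent entries make a diagonal quadratic form linear; this is how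
    [diag d] in [Z] cancels against the shift of [c] by [d]. *)
Lemma quad_diag_idem (R : comPzRingType) m (d x : 'cV[R]_m) :
  (forall k, x k 0 * x k 0 = x k 0) ->
  (x^T *m diag_mx d^T *m x) 0 0 = (d^T *m x) 0 0.
Proof.
move=> xx; rewrite mul_mx_diag !mxE; apply: eq_bigr => k _.
by rewrite !mxE mulrAC xx mulrC.
Qed.

Lemma vec_idem (R : realType) n (X : 'M[R]_n) :
  (forall i j, X i j = 0 \/ X i j = 1) ->
  forall k, vec X k 0 * vec X k 0 = vec X k 0.
Proof.
move=> X01 k; rewrite -[k]mxtens_unindexK; case: (mxtens_unindex k) => j i.
by rewrite vecE; case: (X01 i j) => ->; rewrite ?mul0r ?mul1r.
Qed.

Theorem proposition5 (R : realType) (n : nat)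
    (W : 'M[R]_(n * n)) (c : 'cV[R]_(n * n))
    (X : 'M[R]_n) (hX : permutation_matrix X)
    (d : 'cV[R]_(n * n)) (D1 D2 : 'M[R]_n) :
  fobj W c (vec X) = ftilde W c (vec X) D1 D2 d.
Proof.
have [X01 XtX] := hX.
have q1 : ((vec X)^T *m (D1 *t 1%:M) *m vec X) 0 0 = \tr D1.
  by rewrite quad_tens_vec /frobenius mul1mx mulmxA XtX mul1mx mxtrace_tr.
have q2 : ((vec X)^T *m (1%:M *t D2) *m vec X) 0 0 = \tr D2.
  (* A one-sided inverse of a square matrix is two-sided, so [X X^T = I]. *)
  by rewrite quad_tens_vec /frobenius trmx1 mulmx1 mxtrace_mulC -mulmxA
    (mulmx1C XtX) mulmx1.
have q3 := quad_diag_idem _ _ d _ (vec_idem _ _ _ X01).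
have qZ : ((vec X)^T *m Zmx D1 D2 d *m vec X) 0 0 =
    \tr D1 + \tr D2 + (d^T *m vec X) 0 0.
  by rewrite -q1 -q2 -q3 /Zmx !mulmxDr !mulmxDl [LHS]mxE [X in X + _]mxE.
have qW : ((vec X)^T *m (W - Zmx D1 D2 d) *m vec X) 0 0 =
    ((vec X)^T *m W *m vec X) 0 0 - ((vec X)^T *m Zmx D1 D2 d *m vec X) 0 0.
  by rewrite mulmxBr mulmxBl [LHS]mxE [X in _ + X]mxE.
have qc : ((c + d)^T *m vec X) 0 0 =
    (c^T *m vec X) 0 0 + (d^T *m vec X) 0 0.
  by rewrite linearD mulmxDl [LHS]mxE.
rewrite /fobj /ftilde qW qc qZ /frobenius trmx1 mul1mx linearD /=.
ring.
Qed.
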